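(* Let $b_0$ denote the threshold bias for the connectivity game $\mathcal{C}(S_b,n)$. Then $0.1n\le b_0\le \frac{3n}{7}$.
   Context: $\mathcal{C}(S_b,n)$ is the following game on the edge set of $K_n$ ($n$ large): players alternate; on each turn Maker claims one unclaimed edge, and Breaker claims a set of at most $b$ unclaimed edges all incident to a common vertex (a subgraph of a star with $b$ leaves). The game ends when no unclaimed edges remain. Maker wins if her graph contains a spanning tree of $K_n$; otherwise Breaker wins. The threshold bias is the value $b_0(n)$ such that Breaker wins if $b>b_0$ and Maker wins if $b\le b_0$. Convention: when considering Maker strategies Breaker makes the first move, and when considering Breaker strategies Maker makes the first move. *)

(* Defs.v *)
From mathcomp Require Import all_boot.

Set Implicit Arguments.
Unset Strict Implicit.
Unset Printing Implicit Defensive.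

(* A graph on the vertex set 'I_n is given by its edge set, edges being       *)
(* two-element sets of vertices.                                              *)
Notation graph n := {set {set 'I_n}}.

Definition complete_graph (n : nat) : graph n := [set e : {set 'I_n} | #|e| == 2].

Section Trees.
Variable n : nat.
Implicit Types G T : graph n.

Definition adj G : rel 'I_n := fun u v => (u != v) && ([set u; v] \in G).

Definition connected_graph G : Prop := forall u v, connect (adj G) u v.

(* [ucycle] only asks for distinct vertices: the bound on the length excludes *)
(* the closed walk u, v, u along a single edge.                               *)
Definition acyclic_graph G : Prop :=
  forall c : seq 'I_n, 2 < size c -> ~ ucycle (adj G) c.

Definition spanning_tree T : Prop :=
  [/\ T \subset complete_graph n, connected_graph T & acyclic_graph T].

End Trees.

Variant player := Maker | Breaker.

Definition opponent (p : player) : player :=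
  match p with Maker => Breaker | Breaker => Maker end.

Record position (n : nat) := Position {
  turn : player;
  maker_graph : graph n;
  breaker_graph : graph n
}.

Definition start (n : nat) (first : player) : position n :=
  Position first set0 set0.

Section Game.
Variables n b : nat.
Implicit Types s t : position n.

Definition unclaimed s : graph n :=
  complete_graph n :\: (maker_graph s :|: breaker_graph s).

Definition game_over s : Prop := unclaimed s = set0.

Definition won_by (p : player) s : Prop :=
  let maker_goal := exists2 T : graph n, spanning_tree T & T \subset maker_graph s in
  match p with Maker => maker_goal | Breaker => ~ maker_goal end.

(* Breaker's set S may be empty, "at most b" being read literally.            *)
Variant legal_move : position n -> position n -> Prop :=
| MakerMove M B e :
    e \in unclaimed (Position Maker M B) ->
    legal_move (Position Maker M B) (Position Breaker (e |: M) B)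
| BreakerMove M B (S : graph n) (v : 'I_n) :
    ~ game_over (Position Breaker M B) ->
    S \subset unclaimed (Position Breaker M B) ->
    #|S| <= b ->
    (forall e, e \in S -> v \in e) ->
    legal_move (Position Breaker M B) (Position Maker M (S :|: B)).

(* Player p has a winning strategy from the given position. Every play is     *)
(* finite, since Maker claims an edge at each of her turns.                   *)
Inductive wins (p : player) : position n -> Prop :=
| WinsOver s : game_over s -> won_by p s -> wins p s
| WinsOwnTurn s t : turn s = p -> legal_move s t -> wins p t -> wins p s
| WinsOppTurn s :
    turn s = opponent p -> ~ game_over s ->
    (forall t, legal_move s t -> wins p t) -> wins p s.

End Game.

(* The order of play is a parameter: the custom of letting the opponent of    *)
(* the player under consideration start amounts to treating both values of    *)
(* [first], since moving first is never a disadvantage.                       *)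
Definition threshold_bias (n : nat) (first : player) (b0 : nat) : Prop :=
  forall b : nat,
    (b0 < b -> wins b Breaker (start n first)) /\
    (b <= b0 -> wins b Maker (start n first)).

(* Main.v *)
(* Maker's side: she keeps one active vertex in each component of her graph and
   always moves from the active vertex [w] of largest Breaker-degree among the
   small components (fewer than n/6 vertices), joining it to another component;
   [w] is then retired. A star raises the degree of each vertex but its centre by at
   most 1, so when the maximal active degree reaches m, the retired vertices have
   degree sum at least 1 + ... + m; since Breaker claims at most bn edges, this
   gives m(m+1) <= 4bn, so m + b < 5n/6 and [w] can always leave its component.
   Components with at least n/6 vertices cannot be cut off, as that would take
   more than bn edges.

   Breaker's side: he keeps a set W of vertices untouched by Maker and with no
   claimed edge inside. Each round costs at most two vertices of W (the centre of
   the star is chosen among the vertices that Maker touches, if possible), and raises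
   b of the remaining ones by one level. Two stages of about n/14 levels shrink W from n
   to about 2n/3 and then 4n/9 > b. From then on every star centred in W is a
   threat to isolate its centre u and covers all edges from u to W, so Maker's
   forced reply removes only u from W, while all the others gain a level; the last
   vertex of W is isolated. *)
Require Import Defs.
From mathcomp Require Import all_boot all_order all_algebra zify.
From Stdlib Require Import Classical.

Set Implicit Arguments.
Unset Strict Implicit.
Unset Printing Implicit Defensive.

(** * Finiteness of plays, determinacy and monotonicity in the bias *)

Section GameTheory.
Variables n b : nat.
Implicit Types (s t : position n) (p : player).

(* Breaker may pass, so [unclaimed] alone need not decrease. *)
Definition moves_left s : nat :=
  2 * #|unclaimed s| + (if turn s is Breaker then 1 else 0).

Lemma unclaimedS (M B M' B' : graph n) p p' :
  M \subset M' -> B \subset B' ->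
  unclaimed (Position p' M' B') \subset unclaimed (Position p M B :> position n).
Proof. by move=> sM sB; apply: setDS; apply: setUSS. Qed.

Lemma legal_move_left s t : legal_move b s t -> moves_left t < moves_left s.
Proof.
case=> [M B e eU | M B S v _ _ _ _]; rewrite /moves_left /=.
- suff: #|unclaimed (Position Breaker (e |: M) B)|
        < #|unclaimed (Position Maker M B)| by move=> /=; lia.
  apply: proper_card; apply/properP; split.
    by apply: unclaimedS; rewrite ?subsetUr.
  by exists e => //; rewrite /unclaimed !inE eqxx.
- suff: #|unclaimed (Position Maker M (S :|: B))|
        <= #|unclaimed (Position Breaker M B)| by move=> /=; lia.
  by apply: subset_leq_card; apply: unclaimedS; rewrite ?subsetUr.
Qed.

Lemma moves_left_ind (P : position n -> Prop) :
  (forall s, (forall t, legal_move b s t -> P t) -> P s) -> forall s, P s.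
Proof.
move=> IH s; have [k] := ubnP (moves_left s).
elim: k s => // k IHk s lt_s; apply: IH => t st.
by apply: IHk; have := legal_move_left st; lia.
Qed.

Lemma legal_move_not_over s t : legal_move b s t -> ~ game_over s.
Proof. by case=> // M B e eU E; rewrite E inE in eU. Qed.

Lemma legal_move_exists s : ~ game_over s -> exists t, legal_move b s t.
Proof.
case: s => [[] M B] no.
- have [e eU] : exists e, e \in unclaimed (Position Maker M B).
    by apply/set0Pn/eqP.
  by exists (Position Breaker (e |: M) B); constructor.
- have [e] : exists e, e \in unclaimed (Position Breaker M B).
    by apply/set0Pn/eqP.
  rewrite !inE => /andP[_ /eqP e2].
  have [v _] : exists v, v \in e by apply/set0Pn; rewrite -card_gt0 e2.
  exists (Position Maker M (set0 :|: B)).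
  apply: (@BreakerMove n b M B set0 v no); rewrite ?sub0set ?cards0 // => f.
  by rewrite inE.
Qed.

Lemma player_cases p q : q = p \/ q = opponent p.
Proof. by case: p q => [] []; [left | right | right | left]. Qed.

(** Serves for positions that are already decided: every legal move of either player keeps [P], so
    [p] may answer arbitrarily. *)
Lemma wins_invariant p (P : position n -> Prop) :
  (forall s t, P s -> legal_move b s t -> P t) ->
  (forall s, P s -> won_by p s) -> forall s, P s -> wins b p s.
Proof.
move=> stepP wonP; elim/moves_left_ind => s IH Ps.
have [over|no] := classic (game_over s).
  by apply: WinsOver => //; apply: wonP.
have [tp|to] := player_cases p (turn s).
- have [t st] := legal_move_exists no.
  by apply: (WinsOwnTurn tp st); apply: IH => //; apply: stepP st.
- by apply: WinsOppTurn => // t st; apply: IH => //; apply: stepP st.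
Qed.

(** Zermelo's backward induction. A draw cannot occur, since [won_by Breaker] is the negation of
    [won_by Maker]. *)
Lemma wins_determined p s : wins b p s \/ wins b (opponent p) s.
Proof.
elim/moves_left_ind: s => s IH.
have [over|no] := classic (game_over s).
  have [w|nw] := classic (won_by Maker s); case: p {IH}.
  - by left; apply: WinsOver.
  - by right; apply: WinsOver.
  - by right; apply: WinsOver.
  - by left; apply: WinsOver.
have oppK q : opponent (opponent q) = q by case: q.
wlog tp : p IH / turn s = p.
  move=> wl; have [|to] := player_cases p (turn s); first exact: wl.
  case: (wl (opponent p)) => //; rewrite ?oppK; try by auto.
  by move=> t /IH; tauto.
have [[t st wt]|nw] := classic (exists2 t, legal_move b s t & wins b p t).
  by left; apply: (WinsOwnTurn tp st).
right; apply: WinsOppTurn; rewrite ?oppK // => t st.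
by case: (IH t st) => // wt; case: nw; exists t.
Qed.

End GameTheory.

(** The two strategies are played against each other: induction on one derivation, inversion of the
    other, down to a finished position. *)
Lemma wins_exclusive n b p (s : position n) : wins b p s -> ~ wins b (opponent p) s.
Proof.
have oppN q : q <> opponent q by case: q.
elim=> {s} [s over won | s t tp st _ IH | s to no _ IH] W.
- inversion W as [s' o' w' | s' t' tp' st' _ | s' to' no' _]; subst.
  + by case: p won w' {W}.
  + exact: (legal_move_not_over st').
  + by [].
- inversion W as [s' o' w' | s' t' tp' st' _ | s' to' no' H]; subst.
  + exact: (legal_move_not_over st).
  + exact: (oppN _ tp').
  + exact: (IH (H _ st)).
- inversion W as [s' o' w' | s' t' tp' st' H | s' to' no' _]; subst.
  + by [].
  + exact: (IH _ st' H).
  + by case: p to to' {W IH}=> ->.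
Qed.

Lemma wins_Breaker_mono n b b' (s : position n) :
  b <= b' -> wins b Breaker s -> wins b' Breaker s.
Proof.
move=> le_b; elim=> {s} [s over won | s t tp st _ IH | s to no _ IH].
- exact: WinsOver.
- apply: (WinsOwnTurn tp _ IH).
  case: st tp => // M B S v nov sub card star _.
  by apply: (BreakerMove nov sub _ star); apply: leq_trans le_b.
- apply: WinsOppTurn => // t st; apply: IH.
  by case: st to => // M B e eU _; constructor.
Qed.

(** * Degrees, connectivity and spanning trees *)

Section Graphs.
Variable n : nat.
Implicit Types (G M B S : graph n) (u v w x y : 'I_n) (e : {set 'I_n}).

Definition deg G v : nat := #|[set e in G | v \in e]|.

Lemma edgeE e u v : e \in complete_graph n -> u \in e -> v \in e -> u != v ->
  e = [set u; v].
Proof.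
rewrite inE => /eqP e2 ue ve uv; apply/eqP; rewrite eq_sym eqEcard e2 cards2 uv.
by rewrite andbT; apply/subsetP => x; rewrite !inE => /orP[] /eqP ->.
Qed.

Lemma edge_complete u v : u != v -> [set u; v] \in complete_graph n.
Proof. by move=> uv; rewrite inE cards2 uv. Qed.

Lemma edge_injr w : injective (fun y => [set w; y]).
Proof.
move=> y z /setP E; have := E y; have := E z; rewrite !inE !eqxx !orbT.
have [->|zw] := eqVneq z w; first by rewrite orbb => _ /esym/eqP.
by move=> /= /eqP.
Qed.

Lemma sum_deg G : G \subset complete_graph n -> \sum_v deg G v = 2 * #|G|.
Proof.
move=> sG; rewrite (eq_bigr (fun v => \sum_(e in G) (v \in e))); last first.
  by move=> v _; rewrite /deg -sum1dep_card -big_mkcondr.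
rewrite exchange_big /= (eq_bigr (fun=> 2)) ?sum_nat_const 1?mulnC // => e eG.
have := subsetP sG _ eG; rewrite inE => /eqP <-.
by rewrite -sum1_card [RHS]big_mkcond; apply: eq_bigr => v _; case: (v \in e).
Qed.

Lemma degS G G' v : G \subset G' -> deg G v <= deg G' v.
Proof.
move=> sG; apply: subset_leq_card; apply/subsetP => e; rewrite !inE.
by case/andP=> /(subsetP sG) -> ->.
Qed.

Lemma degU G G' v : deg (G :|: G') v <= deg G v + deg G' v.
Proof.
apply: leq_trans (leq_card_setU _ _); apply: subset_leq_card.
by apply/subsetP=> e; rewrite !inE -andb_orl.
Qed.

Lemma deg_leaf S c v : S \subset complete_graph n ->
  (forall e, e \in S -> c \in e) -> v != c -> deg S v <= 1.
Proof.
move=> sS star vc; rewrite -(cards1 [set v; c]); apply: subset_leq_card.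
apply/subsetP=> e; rewrite !inE => /andP[eS ve]; apply/eqP.
by apply: edgeE => //; [apply: (subsetP sS) | apply: star].
Qed.

Lemma deg_le_card S v : deg S v <= #|S|.
Proof. by apply: subset_leq_card; apply/subsetP=> e; rewrite inE => /andP[]. Qed.

Lemma deg_complete v : deg (complete_graph n) v <= n.-1.
Proof.
rewrite -[n in n.-1]card_ord -(cardsC1 v).
apply: leq_trans (leq_imset_card (fun y => [set v; y]) _).
apply: subset_leq_card; apply/subsetP=> e; rewrite inE => /andP[eK ve]; apply/imsetP.
have := eK; rewrite inE => /cards2P[x] [y] [xy E].
have [vx|vx] := eqVneq v x.
  by exists y; rewrite vx // !inE eq_sym.
exists x; first by rewrite !inE eq_sym.
by apply: edgeE => //; rewrite E !inE eqxx.
Qed.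

Lemma adj_sym G : symmetric (adj G).
Proof. by move=> u v; rewrite /adj eq_sym setUC. Qed.

Lemma connect_adjC G u v : connect (adj G) u v = connect (adj G) v u.
Proof. exact: (sym_connect_sym (@adj_sym G)). Qed.

Lemma connect_adjS G G' u v : G \subset G' ->
  connect (adj G) u v -> connect (adj G') u v.
Proof.
move=> sG; apply: connect_sub => x y /andP[xy eG]; apply: connect1.
by rewrite /adj xy (subsetP sG).
Qed.

(* Deleting an edge of a cycle keeps its endpoints joined by the rest of the cycle. *)
Lemma minimal_connected_acyclic G :
  connected_graph G -> (forall e, e \in G -> ~ connected_graph (G :\ e)) ->
  acyclic_graph G.
Proof.
move=> conn mini [//|x [//|y p]] sz /andP[cyc uniq_c].
move: cyc; rewrite /= => /andP[/andP[xy eG] pathp].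
apply: (mini _ eG) => u v.
(* An edge with an end outside [[set x; y]] survives the deletion; this covers every edge on the way
   from [y] round the cycle back to [x]. *)
have ed_neq a c : (a != x) && (a != y) || (c != x) && (c != y) ->
    [set a; c] != [set x; y].
  move=> H; apply/eqP=> /setP E; have := E a; have := E c; rewrite !inE !eqxx orbT /=.
  by move=> /esym/orP Hc /esym/orP Ha; case/orP: H => /andP[/negPf n1 /negPf n2];
     [case: Ha | case: Hc]; rewrite ?n1 ?n2.
have rest z q : z != x -> z != y -> x \notin q -> y \notin q ->
    path (adj G) z (rcons q x) -> connect (adj (G :\ [set x; y])) z x.
  elim: q z => [|a q IH] z zx zy; rewrite ?inE ?negb_or /=.
    move=> _ _ /andP[/andP[_ zG] _]; apply: connect1.
    by rewrite /adj zx !inE zG ed_neq ?zx ?zy.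
  case/andP; rewrite eq_sym => ax xq /andP[]; rewrite eq_sym => ay yq.
  case/andP=> /andP[za zG] pq; apply: connect_trans (IH a ax ay xq yq pq).
  by apply: connect1; rewrite /adj za !inE zG ed_neq ?zx ?zy.
have conn_yx : connect (adj (G :\ [set x; y])) y x.
  case: p sz pathp uniq_c => [//|z p] _.
  rewrite /= !inE !negb_or => /andP[/andP[yz zG] pp].
  case/and4P=> /and3P[_ xz xp] /andP[_ yp] _ _.
  have zx : z != x by rewrite eq_sym.
  have zy : z != y by rewrite eq_sym.
  apply: connect_trans (rest z p zx zy xp yp pp).
  by apply: connect1; rewrite /adj yz !inE zG ed_neq // zx zy orbT.
apply: connect_sub (conn u v) => a c /andP[ac aG].
have [E|ne] := eqVneq [set a; c] [set x; y]; last first.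
  by apply: connect1; rewrite /adj ac !inE ne.
have : a \in [set x; y] by rewrite -E !inE eqxx.
have : c \in [set x; y] by rewrite -E !inE eqxx orbT.
rewrite !inE => /orP[]/eqP-> /orP[]/eqP->; rewrite ?connect0 //.
by rewrite connect_adjC.
Qed.

(** Edges are deleted as long as connectivity survives; an edge-minimal connected graph is
    acyclic. *)
Lemma connected_spanning_tree G : G \subset complete_graph n ->
  connected_graph G -> exists2 T, spanning_tree T & T \subset G.
Proof.
have [k] := ubnP #|G|; elim: k G => // k IH G ltG sG conn.
have [[e eG conn_e]|mini] :=
  classic (exists2 e, e \in G & connected_graph (G :\ e)).
  have [||| T treeT sT] := IH (G :\ e) => //.
  - by move: ltG; rewrite (cardsD1 e) eG.
  - exact: subset_trans (subsetDl _ _) sG.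
  by exists T => //; apply: subset_trans sT (subsetDl _ _).
exists G => //; split=> //; apply: minimal_connected_acyclic => // e eG conn_e.
by apply: mini; exists e.
Qed.

End Graphs.

(** The function [x * (n - x)] is concave and symmetric about [n / 2], so on the interval from [s]
    to [n - s] it is least at the ends. *)
Lemma concave_cut s c n : s <= c -> c + s <= n -> s * (n - s) <= c * (n - c).
Proof.
move=> sc scn; have [k ->] : exists k, n = c + s + k by exists (n - (c + s)); lia.
have -> : c + s + k - s = c + k by lia.
have -> : c + s + k - c = s + k by lia.
nia.
Qed.

(** * Maker's strategy *)

Section MakerStrategy.
Variables n b s0 : nat.
Implicit Types (G M B S : graph n) (u v w x y : 'I_n) (A : {set 'I_n}).

Definition component G w : {set 'I_n} := [set y | connect (adj G) w y].

Lemma componentS G G' w : G \subset G' -> component G w \subset component G' w.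
Proof.
by move=> sG; apply/subsetP=> y; rewrite !inE; apply: connect_adjS.
Qed.

Lemma cut_not_claimed G w x y :
  x \in component G w -> y \notin component G w -> [set x; y] \notin G.
Proof.
rewrite !inE => wx; apply: contra => eG; apply: connect_trans wx _.
have [->|xy] := eqVneq x y; first exact: connect0.
by apply: connect1; rewrite /adj xy.
Qed.

(** No edge of [M] leaves the component, so if all edges from [w] to the outside were claimed, they
    would all count towards [deg B w]. *)
Lemma free_edge_at M B w :
  #|component M w| + deg B w < n ->
  exists2 y, y \notin component M w & [set w; y] \notin M :|: B.
Proof.
move=> small.
have [/exists_inP[y yC yU]|] :=
  boolP [exists (y | y \notin component M w), [set w; y] \notin M :|: B].
  by exists y.
rewrite negb_exists_in => /forall_inP noy.
suff: #|~: component M w| <= deg B w.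
  by rewrite cardsCs setCK card_ord; lia.
rewrite -(card_imset _ (@edge_injr n w)); apply: subset_leq_card.
apply/subsetP=> _ /imsetP[y yC ->]; rewrite inE in yC.
have := noy y yC; rewrite negbK inE.
rewrite (negPf (cut_not_claimed _ yC)) ?inE ?connect0 //= => ->.
by rewrite eqxx.
Qed.

Lemma free_edge_cut M B w :
  #|B| < #|component M w| * (n - #|component M w|) ->
  exists x y, [/\ x \in component M w, y \notin component M w
                & [set x; y] \notin M :|: B].
Proof.
move=> big; set C := component M w in big *.
have [/existsP[x /existsP[y /and3P[]]]|] := boolP
  [exists x, exists y, [&& x \in C, y \notin C & [set x; y] \notin M :|: B]].
  by exists x, y.
rewrite negb_exists => /forallP noxy.
suff: #|setX C (~: C)| <= #|B|.
  by rewrite cardsX (cardsCs (~: C)) setCK card_ord leqNgt big.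
have inj : {in setX C (~: C) &, injective (fun p => [set p.1; p.2])}.
  move=> [x y] [x' y']; rewrite !inE /= => /andP[xC yC] /andP[xC' yC'] /setP E.
  have xx' : x = x'.
    have := E x; rewrite !inE eqxx /= => /esym/orP[/eqP //|/eqP xy].
    by rewrite -xy xC in yC'.
  rewrite -xx'; congr (_, _).
  have := E y; rewrite !inE eqxx orbT /= => /esym/orP[/eqP yx|/eqP //].
  by rewrite yx xC' in yC.
rewrite -(card_in_imset inj); apply: subset_leq_card.
apply/subsetP=> _ /imsetP[[x y] /setXP[/= xC yC] ->]; rewrite inE in yC.
have := noxy x; rewrite negb_exists => /forallP/(_ y).
by rewrite xC yC /= negbK inE (negPf (cut_not_claimed xC yC)).
Qed.

(* [A] contains a vertex of every component of Maker's graph. Vertices outside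
   [A] are those from which Maker has already moved; as their degrees grew at
   least like 1, 2, 3, ..., the maximal danger [m] is of order [sqrt |B|]. *)
Definition maker_inv M B A : Prop :=
  [/\ M \subset complete_graph n, B \subset complete_graph n,
      forall x, exists2 a, a \in A & connect (adj M) a x,
      #|B| + b * #|A| <= b * n
    & exists m, (forall a, a \in A -> #|component M a| < s0 -> deg B a <= m)
        /\ m * m.+1 <= 2 * \sum_(u | u \notin A) deg B u].

Lemma merge_representatives M A w x y :
  (forall z, exists2 a, a \in A & connect (adj M) a z) ->
  x \in component M w -> y \notin component M w ->
  forall z, exists2 a, a \in A :\ w & connect (adj ([set x; y] |: M)) a z.
Proof.
move=> rep xC yC z; set M' := _ |: M.
have sM : M \subset M' by apply: subsetUr.
have [a aA az] := rep z; have [aw|aw] := eqVneq a w; last first.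
  by exists a; [rewrite !inE aw | apply: connect_adjS az].
have [c cA cy] := rep y; exists c.
  rewrite !inE cA andbT; apply: contraNneq yC => <-; by rewrite inE.
have xy : x != y by apply: contraNneq yC => <-.
apply: connect_trans (connect_adjS sM cy) _.
apply: (@connect_trans _ _ x).
  by apply: connect1; rewrite adj_sym /adj xy !inE eqxx.
rewrite aw in az; apply: connect_adjS sM _; apply: connect_trans az.
by rewrite connect_adjC; rewrite inE in xC.
Qed.

Hypothesis cut_large : b * n < s0 * (n - s0).
Hypothesis danger_small : forall m, m * m.+1 <= 4 * (b * n) -> m + b + s0 <= n.

(** One round: Breaker's star [S], then Maker's reply. If the bound [m] has to become [m.+1], then
    [m * m.+1] grows by [2 * m.+1]; the retired vertex, of degree above [m], pays for this. *)
Lemma maker_step M B A S c :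
  maker_inv M B A -> S \subset complete_graph n -> #|S| <= b ->
  (forall e, e \in S -> c \in e) ->
  connected_graph M \/
  exists e A', [/\ e \in unclaimed (Position Maker M (S :|: B)),
                   #|A'| < #|A| & maker_inv (e |: M) (S :|: B) A'].
Proof.
move=> [sM sB rep cardB [m [dangA sumA]]] sS cardS star.
set B' := S :|: B.
have sB' : B' \subset complete_graph n by rewrite subUset sS.
have leS : forall v, deg B v <= deg B' v by move=> v; apply/degS/subsetUr.
have cardB' : #|B'| <= #|B| + b.
  by apply: leq_trans (leq_card_setU _ _) _; rewrite addnC leq_add2l.
have [conn|nconn] := classic (connected_graph M); [by left | right].
have [x0 [y0 nxy]] : exists x y, ~~ connect (adj M) x y.
  apply: NNPP => no; apply: nconn => x y; apply/negPn/negP => nxy.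
  by apply: no; exists x, y.
have A_gt0 : 0 < #|A|.
  by have [a aA _] := rep x0; apply/card_gt0P; exists a.
have cardBn : #|B| <= b * n by lia.
have cardBn' : #|B'| <= b * n by have := leq_pmulr b A_gt0; lia.
(* Any free edge out of the component of [w] allows [w] to be retired; only the new danger bound is
   left to the separate cases. *)
have finish w x y : w \in A -> x \in component M w -> y \notin component M w ->
    [set x; y] \notin M :|: B' ->
    (exists m', (forall a, a \in A :\ w ->
        #|component M a| < s0 -> deg B' a <= m')
        /\ m' * m'.+1 <= 2 * \sum_(u | u \notin A :\ w) deg B' u) ->
    exists e A', [/\ e \in unclaimed (Position Maker M B'),
                   #|A'| < #|A| & maker_inv (e |: M) B' A'].
  move=> wA xC yC free [m' [dang' sum']].
  have xy : x != y by apply: contraNneq yC => <-.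
  have cA : #|A| = (#|A :\ w|).+1 by rewrite (cardsD1 w A) wA.
  exists [set x; y], (A :\ w); split.
  - by rewrite inE free edge_complete.
  - by rewrite cA.
  split=> //.
  - by rewrite subUset sM andbT sub1set edge_complete.
  - exact: merge_representatives.
  - by move: cardB cardB'; rewrite cA mulnS; clear; lia.
  exists m'; split=> // a aA small; apply: dang' => //.
  by apply: leq_ltn_trans small; apply/subset_leq_card/componentS/subsetUr.
have sumD1 w : w \in A -> \sum_(u | u \notin A) deg B u + deg B' w
    <= \sum_(u | u \notin A :\ w) deg B' u.
  move=> wA; rewrite [leqRHS](bigD1 w) ?inE ?eqxx //= addnC leq_add2l.
  rewrite [leqRHS](eq_bigl (fun u => u \notin A)).
    by apply: leq_sum => u _; apply: leS.
  move=> u; rewrite !inE negb_and negbK.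
  by have [->|] //= := eqVneq u w; rewrite ?wA ?andbF ?andbT.
have [/exists_inP[a0 a0A small0]|] :=
  boolP [exists (a | a \in A), #|component M a| < s0]; last first.
  (* All active components are large. Two of them are disjoint, so each has between [s0] and
     [n - s0] vertices and its cut exceeds Breaker's edges. *)
  rewrite negb_exists_in => /forall_inP big.
  have [w wA wx] := rep x0.
  have yC : y0 \notin component M w.
    rewrite inE; apply: contra nxy; apply: connect_trans.
    by rewrite connect_adjC.
  have [a aA ay] := rep y0.
  have disj : [disjoint component M w & component M a].
    apply/pred0P=> z /=; rewrite !inE; apply/negP=> /andP[wz az].
    case/negP: yC; rewrite inE; apply: connect_trans wz _.
    by apply: connect_trans ay; rewrite connect_adjC.
  have /leqifP := leq_card_setU (component M w) (component M a).
  rewrite disj => /eqP cU.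
  have := max_card (mem (component M w :|: component M a)).
  rewrite cU card_ord => le_n.
  have := big w wA; have := big a aA; rewrite -!leqNgt => biga bigw.
  have [|x [y [xC yC' free]]] := @free_edge_cut M B' w.
    apply: leq_ltn_trans cardBn' (leq_trans cut_large _).
    by apply: concave_cut => //; apply: leq_trans le_n; rewrite leq_add2l.
  apply: (finish w x y) => //; exists m; split.
    by move=> c' /setD1P[_ /big /negPf ->].
  by move: (sumD1 w wA) sumA; clear; lia.
pose P a := (a \in A) && (#|component M a| < s0).
have Pa0 : P a0 by rewrite /P a0A.
case: (@arg_maxnP _ a0 P (deg B') Pa0) => w /andP[wA smallw] maxw.
have degB' v : deg B' v <= deg B v + deg S v by rewrite addnC degU.
(* The retired degrees sum to at most [2 * #|B|], hence [m * m.+1 <= 4 * (b * n)]. *)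
have m_small : m + b + s0 <= n.
  apply: danger_small; apply: leq_trans sumA _.
  have : \sum_(u | u \notin A) deg B u <= 2 * #|B|.
    by rewrite -(sum_deg sB) [leqRHS](bigID (mem A)) /= leq_addl.
  by move: cardBn; clear; lia.
(* [w] may be the centre of the star, so its degree is only bounded by [m + b]. *)
have [|y yC free] := @free_edge_at M B' w.
  move: (degB' w) (dangA w wA smallw) (deg_le_card S w) cardS (smallw) m_small.
  by clear; lia.
apply: (finish w w y) => //; first by rewrite inE connect0.
have [/exists_inP[v /andP[vA vsmall] vm]|] :=
  boolP [exists (v | (v \in A :\ w) && (#|component M v| < s0)), m < deg B' v];
  last first.
  rewrite negb_exists_in => /forall_inP le_m; exists m; split.
    by move=> a aA small; rewrite leqNgt; apply: le_m; rewrite aA.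
  by move: (sumD1 w wA) sumA; clear; lia.
have deg_w : m < deg B' w.
  apply: leq_trans vm _; apply: maxw; rewrite /P vsmall andbT.
  by case/setD1P: vA.
exists m.+1; split; last by move: (sumD1 w wA) sumA deg_w; clear; lia.
have leaf a : a \in A -> #|component M a| < s0 -> a != c -> deg B' a <= m.+1.
  move=> aA small ac; move: (degB' a) (dangA a aA small) (deg_leaf sS star ac).
  by clear; lia.
(* If the centre stays active, then [w] is not the centre, and by maximality its degree, at most
   [m.+1], bounds that of the centre. *)
move=> a /setD1P[aw aA] small; have [ac|] := eqVneq a c; last exact: leaf.
apply: (@leq_trans (deg B' w)); first by apply: maxw; rewrite /P aA.
by apply: leaf => //; rewrite -ac eq_sym.
Qed.

Lemma connected_Maker_wins (s : position n) :
  maker_graph s \subset complete_graph n -> connected_graph (maker_graph s) ->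
  wins b Maker s.
Proof.
move=> sM conn; pose P (s : position n) :=
  maker_graph s \subset complete_graph n /\ connected_graph (maker_graph s).
apply: (@wins_invariant n b Maker P) => // {s sM conn}.
- move=> s t [sM conn] st; case: st sM conn => //= M B e eU sM conn; split=> /=.
    by rewrite subUset sM andbT sub1set; case/setDP: eU.
  by move=> u v; apply: connect_adjS (conn u v); apply: subsetUr.
- by move=> s [sM conn]; apply: connected_spanning_tree.
Qed.

Lemma maker_inv_wins k M B A S c :
  #|A| <= k -> maker_inv M B A -> S \subset complete_graph n -> #|S| <= b ->
  (forall e, e \in S -> c \in e) ->
  wins b Maker (Position Maker M (S :|: B)).
Proof.
elim: k M B A S c => [|k IH] M B A S c leA inv sS cardS star.
  have [_ _ rep _ _] := inv; have [a aA _] := rep c.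
  by rewrite leqn0 cards_eq0 in leA; rewrite (eqP leA) inE in aA.
have [conn|[e [A' [eU ltA inv']]]] := maker_step inv sS cardS star.
  by apply: connected_Maker_wins => //; case: inv.
apply: (WinsOwnTurn (erefl : turn (Position Maker _ _) = Maker) (MakerMove b eU)).
(* On a full board, [maker_step] with an empty star offers no free edge, so it must yield
   connectedness. *)
have [over|no] := classic (game_over (Position Breaker (e |: M) (S :|: B))).
  have star0 f : f \in (set0 : graph n) -> c \in f by rewrite inE.
  have c0 : #|(set0 : graph n)| <= b by rewrite cards0.
  have [conn|[f [_ [fU _ _]]]] := maker_step inv' (sub0set _) c0 star0.
    by apply: connected_Maker_wins => //; case: inv'.
  rewrite set0U in fU.
  have : f \in unclaimed (Position Breaker (e |: M) (S :|: B)) by [].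
  by rewrite over inE.
apply: WinsOppTurn => // t.
move E : (Position _ _ _) => s st; case: st E => // M1 B1 S1 v1 _ S1U cS1 star1.
case=> eM eB; subst M1 B1; apply: (IH _ _ A' S1 v1) => //; first lia.
exact: subset_trans S1U (subsetDl _ _).
Qed.

Lemma Maker_wins_of_bounds first : 0 < n -> wins b Maker (start n first).
Proof.
move=> n_gt0; pose c := Ordinal n_gt0.
have inv0 : maker_inv set0 set0 setT.
  split; rewrite ?sub0set ?cards0 ?cardsT ?card_ord //.
    by move=> x; exists x; rewrite ?inE ?connect0.
  exists 0; split=> // a _ _.
  by rewrite leqn0 cards_eq0; apply/eqP/setP=> e; rewrite !inE.
have winM S c' : S \subset complete_graph n -> #|S| <= b ->
  (forall e, e \in S -> c' \in e) -> wins b Maker (Position Maker set0 S).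
  move=> sS cS star; rewrite -[S]setU0.
  exact: (maker_inv_wins (leqnn _) inv0 sS cS star).
(* Maker moving first is the case of an empty opening star. *)
have winM0 : wins b Maker (start n Maker).
  by apply: (winM set0 c); rewrite ?sub0set ?cards0 // => e; rewrite inE.
case: first => //.
have [over|no] := classic (game_over (start n Breaker)).
  inversion winM0 as [? o w|? ? ? st|]; subst; first exact: WinsOver.
    by case: (legal_move_not_over st).
  by [].
apply: WinsOppTurn => // t.
rewrite /start; move E : (Position _ _ _) => s st; case: st E => // M1 B1 S1 v1 _ S1U cS1 star1.
case=> eM eB; subst M1 B1; rewrite setU0; apply: (winM _ v1) => //.
exact: subset_trans S1U (subsetDl _ _).
Qed.

End MakerStrategy.

(** The slack [9] makes room for bias [b0.+1] whenever [10 * b0 < n]. *)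
Lemma Maker_wins n b first : 200 <= n -> 10 * b <= n + 9 ->
  wins b Maker (start n first).
Proof.
move=> n_large b_small; apply: (@Maker_wins_of_bounds n b (n %/ 6)); try lia.
- have : 6 * b < 5 * (n %/ 6) by lia.
  have : 5 * n <= 6 * (n - n %/ 6) by lia.
  move: (n %/ 6) (n - n %/ 6) => s r; nia.
- move=> m dang; rewrite leqNgt; apply/negP => large.
  (* Then [m * m] is at least [0.49 n^2], while [4 * (b * n)] is at most [0.4 n^2 + 3.6 n]. *)
  have : 7 * n <= 10 * m by lia.
  nia.
Qed.

(** * Breaker's strategy *)

Lemma exists_set_between (T : finType) (A C : {set T}) k :
  A \subset C -> #|A| <= k -> k <= #|C| ->
  exists Q : {set T}, [/\ A \subset Q, Q \subset C & #|Q| = k].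
Proof.
move=> sAC; elim: k => [|k IH] leA leC.
  by exists A; split=> //; apply/eqP; rewrite -leqn0.
have [ltA|] := ltnP #|A| k.+1; last first.
  by move=> geA; exists A; split=> //; apply/eqP; rewrite eqn_leq leA.
have [|Q [sAQ sQC cQ]] := IH ltA; first exact: ltnW.
have /subsetPn[x xC xQ] : ~~ (C \subset Q).
  by apply: contraTN leC => /subset_leq_card; rewrite cQ -ltnNge.
exists (x |: Q); split; first exact: subset_trans sAQ (subsetUr _ _).
  by rewrite subUset sub1set xC.
by rewrite cardsU1 xQ cQ.
Qed.

Section BreakerStrategy.
Variables n b : nat.
Hypothesis n_gt1 : 1 < n.
Implicit Types (M B S : graph n) (u v w c : 'I_n) (W P Q : {set 'I_n}).

Definition untouched M v : Prop := forall e, e \in M -> v \notin e.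

Definition free_edges M B v : graph n :=
  [set e in unclaimed (Position Breaker M B) | v \in e].

Lemma free_edges_card M B v : B \subset complete_graph n ->
  #|free_edges M B v| + deg B v <= n.-1.
Proof.
move=> sB; apply: leq_trans (deg_complete v).
have disj : [disjoint free_edges M B v & [set e in B | v \in e]].
  apply/pred0P=> e /=; rewrite !inE.
  by case: (e \in B); rewrite ?orbT ?andbF.
have /leqifP := leq_card_setU (free_edges M B v) [set e in B | v \in e].
rewrite disj => /eqP <-; apply: subset_leq_card; apply/subsetP=> e.
rewrite !inE; case/orP=> /andP[]; first by case/andP=> _ -> ->.
by move=> /(subsetP sB); rewrite inE => -> ->.
Qed.

Lemma untouched_won (s : position n) v :
  untouched (maker_graph s) v -> won_by Breaker s.
Proof.
move=> unt /= -[T [_ conn _] sT].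
have [y yv] : exists y, y != v.
  have /card_gt0P[y] : 0 < #|[set~ v]| by rewrite cardsC1 card_ord; lia.
  by rewrite !inE; exists y.
have /connectP[[|z p] /= path_p lastp] := conn v y.
  by rewrite lastp eqxx in yv.
case/andP: path_p => /andP[_ vzT] _.
by have := unt _ (subsetP sT _ vzT); rewrite !inE eqxx.
Qed.

Lemma isolated_Breaker_wins M B v p : untouched M v -> free_edges M B v = set0 ->
  wins b Breaker (Position p M B).
Proof.
move=> unt iso; pose I (s : position n) := untouched (maker_graph s) v /\
  free_edges (maker_graph s) (breaker_graph s) v = set0.
apply: (@wins_invariant n b Breaker I) => // {M B p unt iso}; last first.
  by move=> s [unt _]; apply: untouched_won unt.
have shrink M B M' B' : M \subset M' -> B \subset B' ->
    free_edges M B v = set0 -> free_edges M' B' v = set0.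
  move=> sM sB iso; apply/eqP; rewrite -subset0 -iso.
  apply/subsetP=> e; case/setIdP=> eU ve; apply/setIdP; split=> //.
  exact: (subsetP (unclaimedS _ _ sM sB)) eU.
move=> s t [unt iso] st.
case: st unt iso => /= [M B e eU | M B S w _ _ _ _] unt iso; split=> //=.
- move=> f /setU1P[->|/unt //]; apply/negP=> ve.
  by have := in_set0 e; rewrite -iso inE eU ve.
- by apply: shrink iso; rewrite ?subsetUr.
- by apply: shrink iso; rewrite ?subsetUr.
Qed.

(** The free edges at [v] form a star that one move can claim; after that Maker can never reach
    [v]. *)
Lemma Breaker_isolates M B v : untouched M v -> #|free_edges M B v| <= b ->
  wins b Breaker (Position Breaker M B).
Proof.
move=> unt cardF.
have [over|no] := classic (game_over (Position Breaker M B)).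
  by apply: WinsOver => //; apply: (@untouched_won _ v).
have sF : free_edges M B v \subset unclaimed (Position Breaker M B).
  by apply/subsetP=> e; rewrite inE => /andP[].
have star e : e \in free_edges M B v -> v \in e by rewrite inE => /andP[].
apply: (WinsOwnTurn _ (BreakerMove no sF cardF star)) => //.
apply: (@isolated_Breaker_wins _ _ v) => //.
apply/setP=> e; rewrite !inE.
by case: (e \in M); case: (e \in B); case: (v \in e); case: (#|e| == 2).
Qed.

(* [W] spans no claimed edge, so Breaker can still link any two of its vertices. *)
Definition breaker_inv M B W (g : 'I_n -> nat) : Prop :=
  [/\ B \subset complete_graph n,
      forall v, v \in W -> untouched M v,
      forall u v, u \in W -> v \in W -> [set u; v] \notin B
    & forall v, v \in W -> g v <= deg B v].

Lemma breaker_invS M B W W' g g' : breaker_inv M B W g -> W' \subset W ->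
  (forall v, v \in W' -> g' v <= g v) -> breaker_inv M B W' g'.
Proof.
move=> [sB unt noB lev] /subsetP sW leg; split=> //.
- by move=> v /sW /unt.
- by move=> u v /sW uW /sW vW; apply: noB.
- by move=> v vW; apply: leq_trans (leg v vW) _; apply: lev; apply: sW.
Qed.

Lemma breaker_inv_Maker M B W g e :
  breaker_inv M B W g -> breaker_inv (e |: M) B (W :\: e) g.
Proof.
move=> [sB unt noB lev]; split=> //.
- by move=> v /setDP[vW ve] f /setU1P[->|] //; apply: unt.
- by move=> u v /setDP[uW _] /setDP[vW _]; apply: noB.
- by move=> v /setDP[vW _]; apply: lev.
Qed.

Lemma breaker_inv_free M B W g u v : breaker_inv M B W g ->
  u \in W -> v \in W -> u != v ->
  [set u; v] \in unclaimed (Position Breaker M B).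
Proof.
move=> [_ unt noB _] uW vW uv; rewrite inE edge_complete // andbT inE negb_or.
rewrite noB // andbT; apply/negP=> /(unt u uW).
by rewrite !inE eqxx.
Qed.

Lemma breaker_inv_not_over M B W g p : breaker_inv M B W g -> 1 < #|W| ->
  ~ game_over (Position p M B).
Proof.
move=> inv /card_gt1P[u [v [uW vW uv]]] over.
have : [set u; v] \in unclaimed (Position p M B) := breaker_inv_free inv uW vW uv.
by rewrite over inE.
Qed.

Lemma degU_disjoint S B v : [disjoint S & B] ->
  deg (S :|: B) v = deg S v + deg B v.
Proof.
move=> dis; rewrite /deg.
have -> : [set e in S :|: B | v \in e] =
   [set e in S | v \in e] :|: [set e in B | v \in e].
  by apply/setP=> e; rewrite !inE andb_orl.
apply/eqP; rewrite (leq_card_setU _ _).2.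
apply/pred0P=> e /=; rewrite !inE; have := pred0P dis e => /=.
by case: (e \in S); case: (e \in B); rewrite ?andbF.
Qed.

Lemma unclaimed_disjoint M B S : S \subset unclaimed (Position Breaker M B) ->
  [disjoint S & B].
Proof.
move=> sS; apply/pred0P=> e /=; apply/negP=> /andP[/(subsetP sS)].
by rewrite !inE negb_or => /andP[/andP[_ /negPf->]].
Qed.

(** Each new edge contains [c], which lies outside [W], so [W] still spans no claimed edge. *)
Lemma breaker_inv_star M B W g S c Q :
  breaker_inv M B W g -> S \subset unclaimed (Position Breaker M B) ->
  (forall e, e \in S -> c \in e) -> c \notin W ->
  (forall q, q \in Q -> [set c; q] \in S) ->
  breaker_inv M (S :|: B) W (fun v => g v + (v \in Q)).
Proof.
move=> [sB unt noB lev] sS star cW SQ; split=> //.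
- by rewrite subUset sB andbT; apply: subset_trans sS (subsetDl _ _).
- move=> u v uW vW; rewrite inE negb_or noB // andbT.
  apply/negP=> /star; rewrite !inE => /orP[]/eqP E; move: cW; rewrite E.
    by rewrite uW.
  by rewrite vW.
- move=> v vW; rewrite (degU_disjoint _ (unclaimed_disjoint sS)) addnC.
  apply: leq_add (lev v vW); case vQ: (v \in Q) => //.
  by apply/card_gt0P; exists [set c; v]; rewrite !inE SQ // eqxx orbT.
Qed.

(* The star at [u] leaves Maker no other choice than an edge from [u] to the
   outside of [W], so only [u] drops out of [W] while the rest gains a level. *)
Lemma Breaker_finishes k M B W d :
  breaker_inv M B W (fun=> d) -> #|W| = k.+1 -> k <= b ->
  n <= d + k.+1 + b -> n.-1 <= d + b + b -> wins b Breaker (Position Breaker M B).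
Proof.
elim: k M B W d => [|k IH] M B W d inv cW kb dkb d2b.
  have /card_gt0P[v vW] : 0 < #|W| by rewrite cW.
  have [sB unt _ lev] := inv.
  apply: (@Breaker_isolates _ _ v); first exact: unt.
  by move: (free_edges_card M v sB) (lev v vW) dkb; clear; lia.
have /card_gt0P[u uW] : 0 < #|W| by rewrite cW.
have [sB unt _ lev] := inv.
have [leF|gtF] := leqP #|free_edges M B u| b.
  by apply: (Breaker_isolates _ leF); apply: unt.
have cWu : #|W :\ u| = k.+1 by move: cW; rewrite (cardsD1 u) uW => -[].
pose S0 : graph n := [set [set u; w] | w in W :\ u].
have sS0 : S0 \subset free_edges M B u.
  apply/subsetP=> _ /imsetP[w /setD1P[wu wW] ->].
  by rewrite inE (breaker_inv_free inv) 1?eq_sym //= !inE eqxx.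
have cS0 : #|S0| <= b by apply: leq_trans (leq_imset_card _ _) _; rewrite cWu.
(* The edges from [u] to [W] are padded to exactly [b], so that at most [b] edges at [u] stay free:
   the threat. *)
have [S [s0 sF cS]] := exists_set_between sS0 cS0 (ltnW gtF).
have sU : S \subset unclaimed (Position Breaker M B).
  by apply: subset_trans sF _; apply/subsetP=> e; rewrite inE => /andP[].
have star e : e \in S -> u \in e.
  by move/(subsetP sF); rewrite inE => /andP[].
have no : ~ game_over (Position Breaker M B).
  by apply: (breaker_inv_not_over inv); rewrite cW.
have cSb : #|S| <= b by rewrite cS.
apply: (WinsOwnTurn _ (BreakerMove no sU cSb star)) => //.
have [over|no'] := classic (game_over (Position Maker M (S :|: B))).
  by apply: WinsOver => //; apply: (@untouched_won _ u); apply: unt.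
apply: WinsOppTurn => // t.
move E : (Position _ _ _) => s st; case: st E => // M1 B1 f fU [eM eB].
subst M1 B1.
have invS : breaker_inv M (S :|: B) (W :\ u) (fun v => d + (v \in W :\ u)).
  apply: (@breaker_inv_star _ _ _ _ S u) => //.
  - exact: breaker_invS inv (subsetDl _ _) _.
  - by rewrite !inE eqxx.
  - by move=> q qW; apply: (subsetP s0); apply: imset_f.
(* If Maker ignores the threat, [u] is isolated at once. Otherwise [d] rises and [#|W|] drops by
   one, keeping [d + #|W|] constant. *)
have [uf|uf] := boolP (u \in f); last first.
  apply: (@Breaker_isolates _ _ u).
    by move=> e /setU1P[->|] //; apply: unt.
  have [sB' _ _ _] := invS.
  have := free_edges_card (f |: M) u sB'.
  rewrite (degU_disjoint _ (unclaimed_disjoint sU)).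
  have -> : deg S u = b.
    rewrite -cS /deg; apply: eq_card => e; rewrite inE.
    by case eS: (e \in S) => //=; apply: star.
  by move: (lev u uW) d2b; clear; lia.
apply: (IH _ _ (W :\ u) d.+1) => //; try by move: kb dkb d2b; clear; lia.
have := breaker_inv_Maker f invS.
have -> : (W :\ u) :\: f = W :\ u.
  apply/setP=> v; rewrite [LHS]inE; case vW: (v \in W :\ u); rewrite ?andbF ?andbT //.
  apply/negP=> vf; have := fU; rewrite !inE => /andP[nf f2].
  have vu : u != v by rewrite eq_sym; case/setD1P: vW.
  have fE : f = [set u; v] by apply: edgeE; rewrite ?inE.
  by move: nf; rewrite fE (subsetP s0) ?orbT //; apply: imset_f.
move/breaker_invS; apply=> // v vW; by rewrite vW addn1.
Qed.

(** Maker's edge costs at most two of the [b + 3] vertices; the final phase starts from exactly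
    [b.+1] of those left. *)
Lemma Breaker_wins_levels M B W d :
  breaker_inv M B W (fun=> d) -> b + 3 <= #|W| -> n.-1 <= d + b + b ->
  wins b Breaker (Position Maker M B).
Proof.
move=> inv cW d2b.
apply: WinsOppTurn => //; first by apply: (breaker_inv_not_over inv); lia.
move=> t; move E : (Position _ _ _) => s st; case: st E => // M1 B1 e eU [eM eB].
subst M1 B1; have inv' := breaker_inv_Maker e inv.
have ce : #|e| = 2 by move: eU; rewrite !inE => /andP[_ /eqP].
have cWe : b.+1 <= #|W :\: e|.
  by have := subset_leq_card (subsetIr W e); rewrite cardsD; lia.
have c0 : #|(set0 : {set 'I_n})| <= b.+1 by rewrite cards0.
have [W' [_ sW' cW']] := exists_set_between (sub0set _) c0 cWe.
apply: (@Breaker_finishes b _ _ W' d) => //; last lia.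
exact: breaker_invS inv' sW' _.
Qed.

(** If Maker's edge meets [W], the centre is one of its ends and costs nothing extra; otherwise only
    the centre is lost. *)
Lemma star_centre W (e : {set 'I_n}) : #|e| = 2 -> 0 < #|W| ->
  exists2 c, c \in W & #|W| <= #|W :\: (c |: e)| + 2.
Proof.
move=> e2 W_gt0.
have bound c : #|W :&: (c |: e)| <= 2 -> #|W| <= #|W :\: (c |: e)| + 2.
  by rewrite cardsD; lia.
have [/pred0Pn[c /= /andP[cW ce]]|] := boolP (~~ [disjoint W & e]).
  exists c => //; apply: bound; rewrite -e2; apply: subset_leq_card.
  by apply/subsetP=> v /setIP[_ /setU1P[->|]].
rewrite negbK => dis; have /card_gt0P[c cW] := W_gt0.
exists c => //; apply: bound; apply: (@leq_trans #|[set c]|); last by rewrite cards1.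
apply: subset_leq_card; apply/subsetP=> v /setIP[vW /setU1P[->|ve]].
  by rewrite inE.
by have := pred0P dis v; rewrite /= vW ve.
Qed.

(* The vertices of [W] have degree at least [l], and at least [l + 1] off [P];
   Breaker always feeds [b] of the poorest ones, so the missing total
   [#|W| * (h - l.+1) + #|P|] drops by [b] per round. *)
Lemma Breaker_raises_levels K h : 0 < b <= K ->
  (forall M B W, breaker_inv M B W (fun=> h) -> K <= #|W| ->
     wins b Breaker (Position Maker M B)) ->
  forall r M B W P l, l < h -> P \subset W ->
    breaker_inv M B W (fun v => l + (v \notin P)) ->
    #|W| * (h - l.+1) + #|P| <= b * r -> K + 2 * r <= #|W| ->
    wins b Breaker (Position Maker M B).
Proof.
case/andP=> b_gt0 bK cont; elim=> [|r IH] M B W P l lh sPW inv pot cW.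
  have W_gt0 : 0 < #|W| by move: cW b_gt0 bK; clear; lia.
  (* With no rounds left the missing total is zero, so [h = l.+1] and [P] is empty: level [h] is
     reached. *)
  have : #|W| * (h - l.+1) + #|P| == 0 by rewrite -leqn0 -(muln0 b).
  rewrite addn_eq0 muln_eq0 => /andP[/orP[/eqP W0|/eqP hl]].
    by rewrite W0 in W_gt0.
  rewrite cards_eq0 => /eqP P0; have {}hl : h = l.+1 by move: hl lh; clear; lia.
  apply: (cont _ _ W); last by lia.
  by apply: (breaker_invS inv) => // v _; rewrite P0 inE hl addn1.
apply: WinsOppTurn => //; first by apply: (breaker_inv_not_over inv); lia.
move=> t; move E : (Position _ _ _) => s st; case: st E => // M1 B1 e eU [eM eB].
subst M1 B1.
have ce : #|e| = 2 by move: eU; rewrite !inE => /andP[_ /eqP].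
have [|c cinW cW1] := star_centre ce (W := W); first by lia.
set W1 := W :\: (c |: e) in cW1.
have sW1 : W1 \subset W by apply: subsetDl.
have sW1e : W1 \subset W :\: e by apply: setDS; apply: subsetUr.
have cW1K : K + 2 * r <= #|W1| by lia.
have leW1 : #|W1| <= #|W| by apply: subset_leq_card.
have cnW1 : c \notin W1 by rewrite !inE eqxx.
pose P1 := P :&: W1.
have cP1 : #|P1| <= #|P| by apply/subset_leq_card/subsetIl.
have inv1 : breaker_inv (e |: M) B W1 (fun v => l + (v \notin P)).
  exact: breaker_invS (breaker_inv_Maker e inv) sW1e _.
have spoke q : q \in W1 -> [set c; q] \in unclaimed (Position Breaker (e |: M) B).
  move=> qW1; have qW := subsetP sW1 _ qW1.
  have cq : c != q by apply: contraNneq cnW1 => ->.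
  have := breaker_inv_free inv cinW qW cq.
  rewrite !inE !negb_or => /andP[/andP[-> ->] ->]; rewrite !andbT.
  by apply: contraTneq qW1 => eE; rewrite /W1 -eE !inE eqxx !orbT.
have play Q : Q \subset W1 -> #|Q| = b ->
    (breaker_inv (e |: M) ([set [set c; q] | q in Q] :|: B) W1
       (fun v => l + (v \notin P) + (v \in Q)) ->
     wins b Breaker
       (Position Maker (e |: M) ([set [set c; q] | q in Q] :|: B))) ->
    wins b Breaker (Position Breaker (e |: M) B).
  move=> sQ cQ win; set S := [set _ | _ in _] in win.
  have sS : S \subset unclaimed (Position Breaker (e |: M) B).
    by apply/subsetP=> _ /imsetP[q qQ ->]; apply: spoke; apply: (subsetP sQ).
  have cS : #|S| <= b by rewrite -cQ leq_imset_card.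
  have star f : f \in S -> c \in f by case/imsetP=> q _ ->; rewrite !inE eqxx.
  have no : ~ game_over (Position Breaker (e |: M) B).
    have /card_gt0P[q qQ] : 0 < #|Q| by rewrite cQ.
    by move=> over; have := spoke q (subsetP sQ _ qQ); rewrite over inE.
  apply: (WinsOwnTurn _ (BreakerMove no sS cS star)) => //; apply: win.
  by apply: (breaker_inv_star inv1 sS star cnW1) => q qQ; apply: imset_f.
have potW1 : #|W1| * (h - l.+1) + #|P1| <= b * r + b.
  apply: leq_trans (_ : b * r.+1 <= _); last by rewrite mulnS addnC.
  by apply: leq_trans pot; rewrite leq_add // leq_mul2r leW1 orbT.
have c0 : #|(set0 : {set 'I_n})| <= b by rewrite cards0.
have [bP1|P1b] := leqP b #|P1|.
  have [Q [_ sQ cQ]] := exists_set_between (sub0set _) c0 bP1.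
  have sQW1 : Q \subset W1 by apply: subset_trans sQ (subsetIr _ _).
  apply: (play Q sQW1 cQ) => invQ.
  apply: (IH _ _ W1 (P1 :\: Q) l) => //.
  - by apply: subset_trans (subsetDl _ _) (subsetIr _ _).
  - apply: (breaker_invS invQ) => // v vW1; rewrite in_setD in_setI vW1 andbT.
    by clear; case: (v \in P); case: (v \in Q) => /=; lia.
  - by rewrite cardsD (setIidPr sQ) cQ; move: potW1 bP1; clear; lia.
have bW1 : b <= #|W1| by move: bK cW1K; clear; lia.
(* Fewer than [b] poorest vertices remain: all are fed, and the surplus lifts vertices already at
   [l.+1]. The base level becomes [l.+1], and only this surplus lies off the new poor set. *)
have [Q [sP1Q sQ cQ]] := exists_set_between (subsetIr P W1) (ltnW P1b) bW1.
apply: (play Q sQ cQ) => invQ.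
have lev v : v \in W1 -> v \in P -> v \in Q.
  by move=> vW vP; apply: (subsetP sP1Q); rewrite inE vP.
have [lh'|hl] := ltnP l.+1 h; last first.
  apply: (cont _ _ W1); last by move: cW1K; clear; lia.
  apply: (breaker_invS invQ) => // v vW1; have := lev v vW1.
  by move: hl; clear; case: (v \in P); case: (v \in Q) => /=; lia.
apply: (IH _ _ W1 (W1 :\: (Q :\: P1)) l.+1) => //; first exact: subsetDl.
- apply: (breaker_invS invQ) => // v vW1; have := lev v vW1.
  rewrite in_setD vW1 in_setD in_setI vW1 !andbT; clear.
  by case: (v \in P); case: (v \in Q) => /=; lia.
- have sQP : Q :\: P1 \subset W1 by apply: subset_trans (subsetDl _ _) sQ.
  rewrite cardsD (setIidPr sQP) cardsD (setIidPr sP1Q) cQ.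
  have [k hk] : exists k, h = l.+2 + k by exists (h - l.+2); rewrite subnKC.
  have -> : h - l.+2 = k by rewrite hk addKn.
  move: potW1 P1b bW1; have -> : h - l.+1 = k.+1 by rewrite hk addSnnS addKn.
  rewrite mulnS; clear.
  by move: #|W1| #|P1| => w p; lia.
Qed.

(** The missing total is computed afresh from the smaller [W] at the second stage. With [b] near
    [3n/7], a single stage of [n/7] levels would be budgeted [n/3] rounds and guarantee only
    [n/3 < b] vertices. *)
Lemma Breaker_wins_two_stages H r1 r2 K :
  0 < b -> 0 < H -> n * H <= b * r1 -> K + 2 * r1 <= n -> K * H <= b * r2 ->
  b + 3 + 2 * r2 <= K -> n.-1 <= H + H + b + b -> wins b Breaker (start n Maker).
Proof.
move=> b_gt0 H_gt0 pot1 size1 pot2 size2 last_level.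
have full m : m * (H - 1) + m = m * H.
  by rewrite -[X in _ + X]muln1 -mulnDr subnK.
have bK : 0 < b <= K by lia.
apply: (@Breaker_raises_levels K H bK _ r1 _ _ setT setT 0) => //.
- move=> M B W inv cW.
  have c0 : #|(set0 : {set 'I_n})| <= K by rewrite cards0.
  have [W' [_ sW' cW']] := exists_set_between (sub0set _) c0 cW.
  have bb : 0 < b <= b + 3 by lia.
  apply: (@Breaker_raises_levels (b + 3) (H + H) bb _ r2 _ _ W' W' H); last by rewrite cW'.
  + by move=> M' B' W1 inv' cW1; apply: (Breaker_wins_levels inv').
  + by lia.
  + by [].
  + by apply: (breaker_invS inv sW') => v vW'; rewrite vW' addn0.
  + by rewrite cW' -addn1 subnDl full.
- split; rewrite ?sub0set //.
  + by move=> v _ e; rewrite inE.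
  + by move=> u v _ _; rewrite inE.
  + by move=> v _; rewrite inE.
- by rewrite cardsT card_ord full.
- by rewrite cardsT card_ord.
Qed.

End BreakerStrategy.

(** * Concrete constants and the threshold bias *)

Lemma wins_pass n b (p : player) : wins b Breaker (start n Maker) ->
  wins b Breaker (start n p).
Proof.
case: p => // winM.
have [over|no] := classic (game_over (start n Breaker)).
  inversion winM as [? o w|? ? tp|? ? no']; subst; first exact: WinsOver.
    by [].
  by [].
(* Breaker passes with an empty star; the edge merely supplies a vertex to name as its centre. *)
have [e] : exists e, e \in unclaimed (start n Breaker) by apply/set0Pn/eqP.
rewrite !inE => /andP[_ /eqP e2].
have [v _] : exists v, v \in e by apply/set0Pn; rewrite -card_gt0 e2.
apply: (@WinsOwnTurn _ _ _ _ (Position Maker set0 (set0 :|: set0))) => //.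
  apply: (@BreakerMove n b set0 set0 set0 v no); rewrite ?sub0set ?cards0 //.
  by move=> f; rewrite inE.
by rewrite setU0.
Qed.

Lemma Breaker_wins n b p : 2000 <= n -> 3 * n < 7 * b ->
  wins b Breaker (start n p).
Proof.
move=> n_large b_large; apply: wins_pass.
(* The least admissible bias suffices; the size condition [b + 3 + 2 * r2 <= K] fails for large
   [b]. *)
apply: (@wins_Breaker_mono n (3 * n %/ 7).+1); first lia.
have stage1 a H r : 3 * n <= 7 * a -> 7 * H <= 3 * r -> n * H <= a * r.
  by clear; nia.
have stage2 a H r K : 3 * n <= 7 * a -> 14 * H <= 9 * r -> 3 * K <= 2 * n ->
  K * H <= a * r by clear; nia.
(* [H] is chosen so that [2 * H + 2 * b] reaches [n.-1]; [r1] and [r2] then solve [n * H <= b * r1]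
   and [(2n/3) * H <= b * r2] for [b] near [3n/7]. *)
pose H := (n %/ 14).+1.
pose r1 := (7 * H %/ 3).+1; pose r2 := (14 * H %/ 9).+1.
apply: (@Breaker_wins_two_stages n _ _ H r1 r2 (n - 2 * r1)); try lia.
- by apply: stage1; lia.
- by apply: stage2; lia.
Qed.

Lemma wins_Maker_antimono n b b' (s : position n) :
  b' <= b -> wins b Maker s -> wins b' Maker s.
Proof.
move=> le_b winM; case: (wins_determined b' Maker s) => // winB.
by case: (wins_exclusive winM); apply: wins_Breaker_mono winB.
Qed.

(** Descending from [k], the first bias at which Maker wins is the threshold; monotonicity settles
    all other biases. *)
Lemma threshold_bias_exists n first k :
  wins 0 Maker (start n first) -> wins k Breaker (start n first) ->
  exists b0, threshold_bias n first b0.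
Proof.
move=> win0; elim: k => [winB|k IH winB]; first by case: (wins_exclusive win0).
have [winM|] := wins_determined k Maker (start n first); last exact: IH.
exists k => b; split=> lt_b; first exact: wins_Breaker_mono lt_b winB.
exact: wins_Maker_antimono lt_b winM.
Qed.

Lemma threshold_bias_bounds n first b0 : 2000 <= n ->
  threshold_bias n first b0 -> n <= 10 * b0 /\ 7 * b0 <= 3 * n.
Proof.
move=> n_large thr; split; rewrite leqNgt; apply/negP => lt.
- have [winB _] := thr b0.+1.
  apply: (wins_exclusive (winB (ltnSn b0))).
  by apply: Maker_wins; lia.
- have [_ winM] := thr b0.
  exact: (wins_exclusive (winM (leqnn b0)) (Breaker_wins first n_large lt)).
Qed.

Import Order.TTheory GRing.Theory Num.Theory.
Local Open Scope ring_scope.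

Theorem theorem5p3 :
  exists N : nat, forall n : nat, (N <= n)%N -> forall first : player,
    (exists b0 : nat, threshold_bias n first b0) /\
    (forall b0 : nat, threshold_bias n first b0 ->
       (1 / 10) * n%:R <= b0%:R :> rat /\ b0%:R <= (3 * n%:R) / 7 :> rat).
Proof.
exists 2000%N => n n_large first; split.
  (* Bias [n] already exceeds [3n/7], so Breaker wins there. *)
  apply: (@threshold_bias_exists n first n).
    by apply: Maker_wins; lia.
  by apply: Breaker_wins; lia.
move=> b0 /(threshold_bias_bounds n_large)[lo hi]; split.
  by rewrite mul1r mulrC ler_pdivrMr // mulrC -natrM ler_nat.
by rewrite ler_pdivlMr // mulrC -!natrM ler_nat.
Qed.
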